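(* Let $G$ be a finite abelian group of prime power order. Then $\Gamma(G)$ is a cograph if and only if $G$ is (up to isomorphism) either a cyclic group of prime power order or $C_{p^k}\times C_{p^r}$ for some prime $p$ and integers $k,r\ge 1$.
   Context: For a finite group $G$, the co-maximal subgroup graph $\Gamma(G)$ is the simple undirected graph whose vertices are the non-trivial proper subgroups of $G$, two distinct vertices $H,K$ being adjacent if and only if $HK=G$, where $HK=\{hk: h\in H, k\in K\}$. A graph is a cograph if it has no induced subgraph isomorphic to $P_4$, the path on $4$ vertices. $C_n$ denotes the cyclic group of order $n$. *)

(* Defs.v *)
From mathcomp Require Import all_boot all_fingroup all_algebra all_solvable.

Set Implicit Arguments.
Unset Strict Implicit.
Unset Printing Implicit Defensive.

Local Open Scope group_scope.

(* A finite simple graph is given by its adjacency relation on a finType. *)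

Definition path_adj (n : nat) : rel 'I_n :=
  [rel i j : 'I_n | (i.+1 == j :> nat) || (j.+1 == i :> nat)].

Definition has_induced (U V : finType) (eU : rel U) (eV : rel V) : Prop :=
  exists f : U -> V, injective f /\ forall u v : U, eV (f u) (f v) = eU u v.

Definition cograph (V : finType) (e : rel V) : Prop :=
  ~ has_induced (@path_adj 4) e.

Definition comax_vertex (gT : finGroupType) (G : {group gT}) : Type :=
  {H : {group gT} | (H :!=: 1) && (H \proper G)}.

Definition comax_adj (gT : finGroupType) (G : {group gT}) :
    rel (comax_vertex G) :=
  [rel H K : comax_vertex G | (H != K) && (val H * val K == G :> {set gT})].

Lemma comax_adj_irr (gT : finGroupType) (G : {group gT}) :
  irreflexive (@comax_adj gT G).
Proof. by move=> H; rewrite /comax_adj /= eqxx. Qed.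

Lemma comax_adj_sym (gT : finGroupType) (G : {group gT}) :
  symmetric (@comax_adj gT G).
Proof.
move=> H K; rewrite /comax_adj /= eq_sym; congr (_ && _).
by apply/eqP/eqP=> HK; apply: invg_inj; rewrite invMg !invGid.
Qed.

(* The exponent 0 is allowed, so the trivial group has prime power order. *)
Definition prime_power (n : nat) : Prop :=
  exists p k : nat, prime p /\ n = (p ^ k)%N.

(* [Zp n] is the additive group of integers modulo n for every n > 0: unlike
   the type ['Z_n], it is trivial when n = 1. *)
Definition Cn (n : nat) : {group 'Z_n} := Zp_group n.

Lemma Cn_cyclic (n : nat) : cyclic (Cn n).
Proof. by rewrite /= /Zp; case: ifP => _; rewrite ?cyclic1 // Zp_cycle cycle_cyclic. Qed.

Lemma card_Cn (n : nat) : (0 < n)%N -> #|Cn n| = n.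
Proof. exact: card_Zp. Qed.

(* Main.v *)
Require Import Defs.
From mathcomp Require Import all_boot all_fingroup all_algebra all_solvable.

Local Open Scope group_scope.

(** Write r for the rank of the abelian p-group G, that is, the number of
    factors in a decomposition of G as a direct product of nontrivial cyclic
    groups.  The two alternatives of the theorem say together that r <= 2
    ([rank_le2_prime_powerP]).

    If r >= 3, then G = A x B x C with three nontrivial factors, and the
    subgroups A, BC, AB, C form, in this order, an induced path of the graph
    ([dprod3_not_cograph]).

    If r <= 2, then the Frattini subgroup Phi of G has index at most p^2.  By the
    nongenerator property of Phi, HK = G holds as soon as (H Phi)(K Phi) = G,
    and any vertex H that has a neighbour satisfies Phi < H Phi < G; hence H Phi
    has index p and is a maximal subgroup.  Distinct maximal subgroups multiply
    to G, so two vertices that both have neighbours are adjacent or have the same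
    product with Phi: away from its isolated vertices the graph is complete
    multipartite.  In an induced path a - b - c - d the vertices a and c are not
    adjacent, nor are a and d, so c Phi = a Phi = d Phi, which contradicts
    cd = G ([rank_le2_cograph]). *)

(** * Adjacency and induced paths *)

(** Distinctness of adjacent vertices is automatic, since HH = H is proper. *)
Lemma comax_adjE (gT : finGroupType) (G : {group gT}) (H K : comax_vertex G) :
  comax_adj H K = (val H * val K == G :> {set gT}).
Proof.
rewrite /comax_adj /=; case: eqP => // <-; rewrite mulGid.
by case/andP: (valP H) => _ /proper_neq/negbTE.
Qed.

(** No injectivity hypothesis is needed: distinct vertices of the path on four
    vertices have distinct neighbourhoods. *)
Lemma has_induced_P4 (V : finType) (e : rel V) (a b c d : V) :
    irreflexive e -> symmetric e ->
    e a b -> e b c -> e c d -> ~~ e a c -> ~~ e a d -> ~~ e b d ->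
  has_induced (@path_adj 4) e.
Proof.
move=> irr_e sym_e ab bc cd /negbTE ac /negbTE ad /negbTE bd.
pose f (i : 'I_4) := nth a [:: a; b; c; d] i.
have fE u v : e (f u) (f v) = @path_adj 4 u v.
  case: u v => [[|[|[|[|u]]]] ltu] [[|[|[|[|v]]]] ltv] //;
    rewrite /f /path_adj /= ?irr_e //;
    by [rewrite ?ab ?bc ?cd ?ac ?ad ?bd | rewrite sym_e ?ab ?bc ?cd ?ac ?ad ?bd].
exists f; split=> // u v eq_f.
have adj_uv w : @path_adj 4 u w = @path_adj 4 v w by rewrite -!fE eq_f.
have w0 := adj_uv (inord 0); have w1 := adj_uv (inord 1).
have w2 := adj_uv (inord 2); have w3 := adj_uv (inord 3).
apply/val_inj; move: w0 w1 w2 w3; rewrite /path_adj /= !inordK //.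
by case: u v {eq_f adj_uv} => [[|[|[|[|u]]]] ltu] [[|[|[|[|v]]]] ltv].
Qed.

(** * Three direct factors *)

(** The induced path is A - BC - AB - C.  Each of its nonadjacent pairs lies in one
    of the proper subgroups AB, AC and BC. *)
Lemma dprod3_not_cograph (gT : finGroupType) (A B C G : {group gT}) :
    A \x (B \x C) = G -> A :!=: 1 -> B :!=: 1 -> C :!=: 1 ->
  ~ cograph (@comax_adj gT G).
Proof.
move=> defG ntA ntB ntC; apply.
have [[_ D _ defD] _ _ _] := dprodP defG.
move: defG; rewrite defD => /dprodP[_ defG cAD tiAD].
have [_ defBC cBC tiBC] := dprodP defD.
have sBD : B \subset D by rewrite -defBC mulG_subl.
have sCD : C \subset D by rewrite -defBC mulG_subr.
have cAB := subset_trans sBD cAD; have cAC := subset_trans sCD cAD.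
have sAG : A \subset G by rewrite -defG mulG_subl.
have sDG : D \subset G by rewrite -defG mulG_subr.
have sBG := subset_trans sBD sDG; have sCG := subset_trans sCD sDG.
have gt1 (X : {group gT}) : X :!=: 1 -> 1 < #|X| by rewrite cardG_gt1.
have oG : #|G| = (#|A| * (#|B| * #|C|))%N.
  by rewrite -defG TI_cardMg // -defBC TI_cardMg.
have prop (X : {set gT}) : X \subset G -> #|X| < #|G| -> X \proper G.
  by move=> sXG ltX; rewrite properEcard sXG.
have oM (X Y : {group gT}) : #|X * Y| <= #|X| * #|Y|.
  by rewrite mul_cardG leq_pmulr ?cardG_gt0.
have prAB : A <*> B \proper G.
  rewrite prop ?join_subG ?sAG // cent_joinEr // (leq_ltn_trans (oM _ _)) //.
  by rewrite oG mulnA ltn_Pmulr ?gt1 // muln_gt0 !cardG_gt0.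
have prAC : A <*> C \proper G.
  rewrite prop ?join_subG ?sAG // cent_joinEr // (leq_ltn_trans (oM _ _)) //.
  by rewrite oG mulnCA ltn_Pmull ?gt1 // muln_gt0 !cardG_gt0.
have prD : D \proper G.
  by rewrite prop // -defG TI_cardMg // ltn_Pmull ?gt1 // cardG_gt0.
have vA : (A :!=: 1) && (A \proper G).
  by rewrite ntA (sub_proper_trans (joing_subl A B)).
have vC : (C :!=: 1) && (C \proper G).
  by rewrite ntC (sub_proper_trans (joing_subr A C)).
have vD : (D :!=: 1) && (D \proper G).
  by rewrite prD andbT; apply: contraNneq ntB => D1; rewrite -subG1 -D1.
have vAB : ((A <*> B)%G :!=: 1) && ((A <*> B)%G \proper G).
  by rewrite prAB andbT; apply: contraNneq ntA => AB1; rewrite -subG1 -AB1 joing_subl.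
have nonadj (X Y L : {group gT}) :
    X \subset L -> Y \subset L -> L \proper G -> X * Y != G.
  move=> sXL sYL; apply: contraTneq => defXY.
  by rewrite properE -defXY mul_subG ?andbF.
pose vtx (X : {group gT}) vX : comax_vertex G := exist _ X vX.
apply: (@has_induced_P4 _ _ (vtx A vA) (vtx D vD) (vtx _ vAB) (vtx C vC));
  rewrite ?comax_adjE /=.
- exact: comax_adj_irr.
- exact: comax_adj_sym.
- by rewrite defG.
- by rewrite cent_joinEr // mulgA (centC cAD) -mulgA (mulGSid sBD) defG.
- by rewrite cent_joinEr // -mulgA defBC defG.
- by rewrite (nonadj _ _ (A <*> B)%G) ?joing_subl.
- by rewrite (nonadj _ _ (A <*> C)%G) ?joing_subl ?joing_subr.
- by rewrite (nonadj _ _ D).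
Qed.

(** * Rank at most two *)

Section AbelianPgroup.

Variables (gT : finGroupType) (p : nat) (G : {group gT}).
Hypotheses (pG : p.-group G) (cGG : abelian G).

Lemma joing_Phi_eq (H : {group gT}) : H <*> 'Phi(G) = G -> H :=: G.
Proof. by rewrite joingC => /Phi_nongen; rewrite genGid. Qed.

Lemma joing_Phi_proper (H : {group gT}) :
  H \proper G -> H <*> 'Phi(G) \proper G.
Proof.
move=> prH; rewrite properEneq join_subG Phi_sub (proper_sub prH) !andbT.
by apply: contraTneq prH => /joing_Phi_eq->; rewrite properxx.
Qed.

(** Adjacency may be tested modulo the Frattini subgroup. *)
Lemma mulg_joing_Phi (H K : {group gT}) :
    H \subset G -> K \subset G ->
  (H <*> 'Phi(G)) * (K <*> 'Phi(G)) = G -> H * K = G.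
Proof.
move=> sHG sKG defG.
have cHK : K \subset 'C(H) := sub_abelian_cent2 cGG sKG sHG.
rewrite -(cent_joinEr cHK); apply: joing_Phi_eq; apply/eqP.
rewrite eqEsubset !join_subG sHG sKG Phi_sub /= -{1}defG mul_subG //.
  by rewrite join_subG joing_subr andbT (subset_trans (joing_subl H K)) ?joing_subl.
by rewrite join_subG joing_subr andbT (subset_trans (joing_subr H K)) ?joing_subl.
Qed.

Lemma index_Phi_rank_le2 : 'r(G) <= 2 -> #|G : 'Phi(G)| %| p ^ 2.
Proof.
move=> rG; have abQ := Phi_quotient_abelem pG.
rewrite -card_quotient ?gFnorm // (card_pgroup (abelem_pgroup abQ)).
rewrite dvdn_exp2l // -(rank_abelem abQ).
exact: leq_trans (quotient_rank_abelian _ cGG) rG.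
Qed.

(** The index of Phi(G) divides p^2, so H Phi(G) has index p once both inclusions
    Phi(G) < H Phi(G) < G are strict; the left one is, because otherwise
    G = HK = K Phi(G) and K would not be proper. *)
Lemma maximal_joing_Phi (H K : {group gT}) :
    prime p -> 'r(G) <= 2 -> H \proper G -> K \proper G -> H * K = G ->
  maximal (H <*> 'Phi(G)) G.
Proof.
move=> p_pr rG prH prK defG; set M := H <*> 'Phi(G).
have prM : M \proper G := joing_Phi_proper H prH.
have sMG := proper_sub prM.
have sPhiM : 'Phi(G) \subset M := joing_subr _ _.
have iM1 : #|G : M| != 1%N by rewrite indexg_eq1 proper_subn.
have iPhi1 : #|M : 'Phi(G)| != 1%N.
  rewrite indexg_eq1; apply/negP=> sMPhi.
  have := joing_Phi_proper K prK; rewrite properE => /andP[_ /negP[]].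
  rewrite -{1}defG mul_subG ?joing_subl //.
  apply: subset_trans (joing_subr _ _).
  exact: subset_trans (joing_subl _ _) sMPhi.
have := index_Phi_rank_le2 rG; rewrite -(Lagrange_index sMG sPhiM).
move=> dvd; apply: p_index_maximal => //.
have /(dvdn_pfactor _ _ p_pr)[m _ iM] := dvdn_trans (dvdn_mulr _ (dvdnn #|G : M|)) dvd.
have /(dvdn_pfactor _ _ p_pr)[n _ iPhi] :=
  dvdn_trans (dvdn_mull _ (dvdnn #|M : 'Phi(G)|)) dvd.
move: dvd iM1 iPhi1; rewrite iM iPhi -expnD dvdn_Pexp2l ?prime_gt1 //.
by case: m n {iM iPhi} => [|[|m]] [|n] //; rewrite addnS.
Qed.

Lemma rank_le2_cograph : prime p -> 'r(G) <= 2 -> cograph (@comax_adj gT G).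
Proof.
move=> p_pr rG [f [_ fE]].
(* The vertices v 0, v 1, v 2, v 3 are those of the path, in order. *)
pose v i := f (inord i : 'I_4).
have adjE i j : i < 4 -> j < 4 ->
    (val (v i) * val (v j) == G :> {set gT}) = (i.+1 == j) || (j.+1 == i).
  by move=> lti ltj; rewrite -comax_adjE fE /path_adj /= !inordK.
have prv i : val (v i) \proper G by case/andP: (valP (v i)).
have maxv i j : i < 4 -> j < 4 -> (i.+1 == j) || (j.+1 == i) ->
    maximal (val (v i) <*> 'Phi(G)) G.
  by move=> lti ltj; rewrite -adjE // => /eqP; apply: maximal_joing_Phi.
(* Distinct maximal subgroups multiply to G, which would make v i and v j
   adjacent. *)
have sub_nonadj i j : i < 4 -> j < 4 -> ~~ ((i.+1 == j) || (j.+1 == i)) ->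
    maximal (val (v i) <*> 'Phi(G)) G -> maximal (val (v j) <*> 'Phi(G)) G ->
  val (v j) <*> 'Phi(G) \subset val (v i) <*> 'Phi(G).
  move=> lti ltj nadj maxi maxj; apply: contraR nadj => nsub.
  rewrite -adjE //; apply/eqP/mulg_joing_Phi; rewrite ?proper_sub //.
  apply: mulg_normal_maximal => //; first exact: (p_maximal_normal pG maxi).
  exact: proper_sub (joing_Phi_proper _ (prv j)).
have max0 := maxv 0 1%N isT isT isT.
have sub2 := sub_nonadj 0 2 isT isT isT max0 (maxv 2 3 isT isT isT).
have sub3 := sub_nonadj 0 3 isT isT isT max0 (maxv 3 2 isT isT isT).
have /eqP def23 : val (v 2) * val (v 3) == G :> {set gT} by rewrite adjE.
have /andP[_ /negP[]] := joing_Phi_proper _ (prv 0).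
by rewrite -{1}def23 mul_subG // (subset_trans (joing_subl _ 'Phi(G))).
Qed.

End AbelianPgroup.

(** * Rank and decompositions into cyclic factors *)

Lemma rank_cyclic_le1 (gT : finGroupType) (G : {group gT}) :
  cyclic G -> 'r(G) <= 1.
Proof. by move=> cycG; rewrite -abelian_rank1_cyclic ?cyclic_abelian. Qed.

Lemma isog_setX1 (gT rT : finGroupType) (H : {group gT}) :
  H \isog setX H [1 rT].
Proof. by rewrite -morphim_pairg1 sub_isog ?subsetT ?injm_pairg1. Qed.

Lemma isog_set1X (gT rT : finGroupType) (K : {group rT}) :
  K \isog setX [1 gT] K.
Proof. by rewrite -morphim_pair1g sub_isog ?subsetT ?injm_pair1g. Qed.

Lemma rank_setX_cyclic (gT rT : finGroupType) (H : {group gT}) (K : {group rT}) :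
  cyclic H -> cyclic K -> 'r(setX H K) <= 2.
Proof.
move=> cycH cycK; have [q _ ->] := rank_witness (setX_group H K).
rewrite -(p_rank_dprod q (setX_dprod H K)).
rewrite -(isog_p_rank (isog_setX1 _ rT H)) -(isog_p_rank (isog_set1X gT _ K)).
by rewrite (@leq_add _ _ 1 1) // (leq_trans (p_rank_le_rank _ _)) ?rank_cyclic_le1.
Qed.

Lemma isog_setX_Cn (gT : finGroupType) (G : {group gT}) (x y : gT) :
  <[x]> \x <[y]> = G -> G \isog setX (Cn #[x]) (Cn #[y]).
Proof.
have isoC (z : gT) : <[z]> \isog Cn #[z].
  by rewrite isog_cyclic_card ?cycle_cyclic // Cn_cyclic card_Cn ?order_gt0 /=.
move=> defG; apply: (isog_dprod defG (setX_dprod (Cn #[x]) (Cn #[y]))).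
  exact: isog_trans (isoC x) (isog_setX1 _ _ _).
exact: isog_trans (isoC y) (isog_set1X _ _ _).
Qed.

Lemma rank_le2_prime_powerP (gT : finGroupType) (G : {group gT}) :
    abelian G -> prime_power #|G| ->
  'r(G) <= 2 <->
    (cyclic G /\ prime_power #|G|) \/
    (exists p k r : nat,
       [/\ prime p, (1 <= k)%N, (1 <= r)%N
         & G \isog setX (Cn (p ^ k)) (Cn (p ^ r))]).
Proof.
move=> cGG ppG; split=> [rG|]; last first.
  case=> [[cycG _]|[p [k [r [_ _ _ isoG]]]]].
    exact: leq_trans (rank_cyclic_le1 _ _ cycG) _.
  by rewrite (isog_rank isoG) rank_setX_cyclic ?Cn_cyclic.
have [r1|] := leqP 'r(G) 1; first by left; rewrite abelian_rank1_cyclic.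
move=> r2; have {r2} {}rG : 'r(G) = 2 by apply/eqP; rewrite eqn_leq rG.
right; have [p [n [p_pr oG]]] := ppG.
have [b defG ob] := abelian_structure cGG.
have := abelian_type_gt1 G; rewrite -ob.
have : size b = 2 by rewrite -(size_map order) ob size_abelian_type.
case: b defG {ob} => [|x [|y []]] //.
rewrite !big_cons big_nil dprodg1 => defG _ /and3P[/= x1 y1 _].
have pow z : z \in G -> 1 < #[z] -> exists2 k, 1 <= k & #[z] = (p ^ k)%N.
  move=> Gz; have := order_dvdG Gz; rewrite oG => /(dvdn_pfactor _ _ p_pr)[k _ ->].
  by case: k => // k _; exists k.+1.
have [sxG syG] : <[x]> \subset G /\ <[y]> \subset G.
  by rewrite -(dprodW defG) mulG_subl mulG_subr.
have [k k1 ox] := pow x (subsetP sxG _ (cycle_id x)) x1.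
have [r r1 oy] := pow y (subsetP syG _ (cycle_id y)) y1.
by exists p, k, r; split=> //; rewrite -ox -oy isog_setX_Cn.
Qed.

Lemma rank_ge3_not_cograph (gT : finGroupType) (G : {group gT}) :
  abelian G -> 2 < 'r(G) -> ~ cograph (@comax_adj gT G).
Proof.
move=> cGG rG; have [b defG ob] := abelian_structure cGG.
have := abelian_type_gt1 G; move: rG; rewrite -size_abelian_type // -ob size_map.
case: b defG {ob} => [|x [|y [|z s]]] //; rewrite 2!big_cons => defG _.
case/and4P=> /= x1 y1 z1 _.
have [[_ D _ defD] _ _ _] := dprodP defG.
have [[_ C _ defC] _ _ _] := dprodP defD.
move: (defG); rewrite defC => /dprod3_not_cograph; apply; rewrite -?cardG_gt1 //.
apply: leq_trans (z1 : 1 < #|<[z]>|) (subset_leq_card _).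
rewrite big_cons in defC; have [[_ E _ defE] defC' _ _] := dprodP defC.
by rewrite -defC' defE mulG_subl.
Qed.

Theorem theorem5p4 (gT : finGroupType) (G : {group gT})
    (abelG : abelian G) (ppG : prime_power #|G|) :
  cograph (@comax_adj gT G) <->
  (cyclic G /\ prime_power #|G|) \/
  (exists p k r : nat,
     [/\ prime p, (1 <= k)%N, (1 <= r)%N
       & G \isog setX (Cn (p ^ k)) (Cn (p ^ r))]).
Proof.
apply: iff_trans (rank_le2_prime_powerP _ _ abelG ppG).
split=> [cogG | rG].
  by rewrite leqNgt; apply/negP=> /(rank_ge3_not_cograph _ _ abelG).
have [p [n [p_pr oG]]] := ppG.
have pG : p.-group G by rewrite /pgroup oG pnatX pnat_id.
exact: rank_le2_cograph pG abelG p_pr rG.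
Qed.
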